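(* Let $l \geq 1$ be a fixed integer. Then for every integer $m \geq l$, \[ \nu_2(A_{l,m+1}) - \nu_2(A_{l,m}) = \nu_2(m+l+1) - \nu_2(m-l+1). \]
   Context: For integers $m \geq 1$ and $0 \leq l \leq m$, $A_{l,m} = \frac{l!\, m!}{2^{m-l}} \sum_{k=l}^{m} 2^{k} \binom{2m-2k}{m-k}\binom{m+k}{m}\binom{k}{l}$ (these are nonzero integers). $\nu_2$ denotes the $2$-adic valuation. *)

(* Defs.v *)
From HB Require Import structures.
From mathcomp Require Export all_boot all_order all_algebra.
Set Implicit Arguments.
Unset Strict Implicit.
Unset Printing Implicit Defensive.
Import Order.TTheory GRing.Theory Num.Theory.
Local Open Scope ring_scope.

(* The 2-adic valuation on the rationals, extending [logn 2] on the integers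
   (see [nu2_int]); the junk value at 0 is 0. *)
Definition nu2 (q : rat) : int :=
  (logn 2 `|numq q|%N)%:Z - (logn 2 `|denq q|%N)%:Z.

Lemma nu2_int (z : int) : nu2 z%:~R = (logn 2 `|z|%N)%:Z.
Proof. by rewrite /nu2 numq_int denq_int logn1 subr0. Qed.

(* Rational-valued, so that the division by 2 ^ (m - l) is exact without
   presupposing that A l m is an integer; only meaningful for l <= m. *)
Definition A (l m : nat) : rat :=
  (l`! * m`!)%:R / 2%:R ^+ (m - l) *
  \sum_(l <= k < m.+1)
    (2 ^ k * 'C(2 * m - 2 * k, m - k) * 'C(m + k, m) * 'C(k, l))%:R.

(* Main.v *)
Require Import Defs.
From mathcomp Require Import all_boot all_order all_algebra.
From mathcomp Require Import zify ring.
Set Implicit Arguments.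
Unset Strict Implicit.
Unset Printing Implicit Defensive.
Import Order.TTheory GRing.Theory Num.Theory.
Local Open Scope ring_scope.

(** Write [A l m = 2^l (m+l)! / (m-l)! * B l m].  The claim is that [B l m] is
    an odd integer.  The ratio of consecutive coefficients
    [c_k = 2^k C(2m-2k,m-k) C(m+k,m)] is rational in [k], so the polynomial
    [\sum_k c_k (a+1)^k] satisfies a second-order differential equation; reading
    off coefficients of powers of [a] gives
    [B (l-1) m = (2m+1) B l m - (m-l) (m+l+1) B (l+1) m], with [B m m = 1].
    One of [m-l] and [m+l+1] is even, so descending induction on [l] shows that
    every [B l m] is odd. *)

Definition coef (m k : nat) : nat :=
  (2 ^ k * 'C(2 * m - 2 * k, m - k) * 'C(m + k, m))%N.

(** The coefficient of [a^l] in [\sum_k c_k (a+1)^k]. Summing from [0] adds only zero terms and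
    makes the range independent of [l]. *)
Definition binom_transform (m l : nat) : rat :=
  \sum_(0 <= k < m.+1) (coef m k * 'C(k, l))%:R.

Lemma central_binS n :
  (n.+1 * 'C(2 * n.+1, n.+1) = 2 * (2 * n).+1 * 'C(2 * n, n))%N.
Proof.
have -> : (2 * n.+1 = (2 * n).+2)%N by lia.
have e1 := mul_bin_diag (2 * n).+2 n; have e2 := mul_bin_down (2 * n).+1 n.
rewrite /= in e1 e2; have e3 : ((2 * n).+1 - n = n.+1)%N by lia.
by rewrite e3 in e2; nia.
Qed.

(** With [m = k + n + 1], both binomials change by rational factors; after clearing denominators,
    [k < m] prevents truncation. *)
Lemma coefS m k : (k < m)%N ->
  (coef m k.+1 * (2 * (m - k) - 1) * k.+1 = coef m k * (m - k) * (m + k).+1)%N.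
Proof.
move=> ltkm; rewrite /coef.
have [n ->] : exists n, m = (k + n.+1)%N by exists (m - k.+1)%N; lia.
set M := (k + n.+1)%N.
have -> : (2 * M - 2 * k.+1 = 2 * n)%N by lia.
have -> : (2 * M - 2 * k = 2 * n.+1)%N by lia.
have -> : (M - k.+1 = n)%N by lia.
have -> : (M - k = n.+1)%N by lia.
have -> : (2 * n.+1 - 1 = (2 * n).+1)%N by lia.
have e1 := central_binS n.
have e2 : (k.+1 * 'C(M + k.+1, M) = (M + k).+1 * 'C(M + k, M))%N.
  have := mul_bin_down (M + k).+1 M.
  rewrite /= addnS => ->; congr (_ * _)%N; lia.
rewrite expnS.
transitivity (2 ^ k * (2 * (2 * n).+1 * 'C(2 * n, n)) * (k.+1 * 'C(M + k.+1, M)))%N.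
  by ring.
by rewrite e2 -e1; ring.
Qed.

(** For [k < l] the difference is negative, but both binomials vanish, so the identity survives the
    passage from truncated to true subtraction. *)
Lemma mulr_bin_left k l :
  l.+1%:R * 'C(k, l.+1)%:R = (k%:R - l%:R) * 'C(k, l)%:R :> rat.
Proof.
rewrite -natrM mul_bin_left natrM.
by case: (leqP l k) => [/natrB -> // | ltkl]; rewrite bin_small // !mulr0.
Qed.

(** The difference of the two sides telescopes: its terms are [G k.+1 - G k] for [k < m], and the
    last one is [- G m]. *)
Lemma binom_transform_rec m l : (l < m)%N ->
  (m%:R + l%:R + 1) * (m%:R - l%:R) * binom_transform m l =
  (2 * m%:R + 1) * l.+1%:R * binom_transform m l.+1
  - l.+1%:R * l.+2%:R * binom_transform m l.+2.
Proof.
move=> ltlm.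
pose c k : rat := (coef m k)%:R.
pose t k : rat := (m%:R + l%:R + 1) * (m%:R - l%:R) * (coef m k * 'C(k, l))%:R
  - (2 * m%:R + 1) * l.+1%:R * (coef m k * 'C(k, l.+1))%:R
  + l.+1%:R * l.+2%:R * (coef m k * 'C(k, l.+2))%:R.
suff S0 : \sum_(0 <= k < m.+1) t k = 0.
  move: S0; rewrite /t big_split sumrB /= -!mulr_sumr -!/(binom_transform _ _).
  by move=> S0; apply/eqP; rewrite -subr_eq0 -S0; apply/eqP; ring.
(* The factor [2m - 2k + 1] becomes at [k + 1] the [2(m - k) - 1] of [coefS]. *)
pose G k : rat := c k * (2 * m%:R - 2 * k%:R + 1) * (l.+1%:R * 'C(k, l.+1)%:R).
have tE k : t k = c k * (m%:R - k%:R) * (m%:R + k%:R + 1) * 'C(k, l)%:R - G k.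
  rewrite /t /G !(natrM _ (coef m k)) -/(c k).
  have e1 := mulr_bin_left k l; have e2 := mulr_bin_left k l.+1.
  have -> : l.+1%:R * l.+2%:R * (c k * 'C(k, l.+2)%:R)
     = c k * l.+1%:R * (l.+2%:R * 'C(k, l.+2)%:R) by ring.
  rewrite e2.
  have -> : c k * l.+1%:R * ((k%:R - l.+1%:R) * 'C(k, l.+1)%:R)
     = c k * (k%:R - l.+1%:R) * (l.+1%:R * 'C(k, l.+1)%:R) by ring.
  have -> : (2 * m%:R + 1) * l.+1%:R * (c k * 'C(k, l.+1)%:R)
     = (2 * m%:R + 1) * c k * (l.+1%:R * 'C(k, l.+1)%:R) by ring.
  by rewrite e1 -(natr1 l); ring.
have GS k : (k < m)%N ->
  G k.+1 = c k * (m%:R - k%:R) * (m%:R + k%:R + 1) * 'C(k, l)%:R.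
  move=> ltkm; rewrite /G /c; move: (coefS ltkm).
  move: (coef m k.+1) (coef m k) => c1 c0 /(congr1 (fun n => n%:R : rat)).
  rewrite !natrM natrB ?natrM ?natrB 1?ltnW //; last by lia.
  rewrite -(natr1 (m + k)) natrD => e.
  have -> : l.+1%:R * 'C(k.+1, l.+1)%:R = k.+1%:R * 'C(k, l)%:R :> rat.
    by rewrite -!natrM -mul_bin_diag.
  rewrite -addrA -e -(natr1 k); ring.
have part n : (n <= m)%N -> \sum_(0 <= k < n) t k = G n.
  elim: n => [|n IH] lenm; first by rewrite big_geq // /G bin0n /= !mulr0.
  by rewrite big_nat_recr //= IH 1?ltnW // tE -GS // addrCA subrr addr0.
(* At [k = m] the factor [m - k] kills the first part of [t]. *)
by rewrite big_nat_recr //= part // tE subrr; ring.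
Qed.

Lemma binom_transform_diag m : binom_transform m m = (2 ^ m * 'C(2 * m, m))%:R.
Proof.
rewrite /binom_transform big_nat_recr //= big1_seq => [|k]; last first.
  by rewrite mem_index_iota => /andP[_ /andP[_ ltkm]]; rewrite bin_small ?muln0.
by rewrite add0r /coef !subnn bin0 binn !muln1 addnn mul2n.
Qed.

Lemma binom_transform_gt m l : (m < l)%N -> binom_transform m l = 0.
Proof.
move=> ltml; rewrite /binom_transform big1_seq // => k.
rewrite mem_index_iota => /andP[_ /andP[_ lekm]].
by rewrite bin_small ?muln0 //; apply: leq_trans ltml.
Qed.

(* The second equation carries the predecessor in the recursion; its factor
   [m - l] makes it vacuous at the start [l = m]. *)
Lemma binom_transform_odd m j l : (l + j = m)%N ->
  exists b e : int, [/\ odd `|b|,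
    (l`! * m`! * j`!)%:R * binom_transform m l = (2 ^ m * (m + l)`!)%:R * b%:~R &
    (l.+1`! * m`! * j`!)%:R * binom_transform m l.+1
      = (2 ^ m * (m + l).+1`! * j)%:R * e%:~R].
Proof.
elim: j l => [|j IH] l lj.
  have {lj} -> : l = m by rewrite -lj addn0.
  exists 1, 0; split=> //; last by rewrite binom_transform_gt // !mulr0.
  rewrite binom_transform_diag mulr1 -natrM; congr _%:R.
  have := @bin_fact (2 * m) m; rewrite mul2n -addnn addnK => /(_ (leq_addr _ _)) <-.
  by rewrite fact0; ring.
have [|b [e [ob eb ee]]] := IH l.+1; first by rewrite addSnnS.
have ltlm : (l < m)%N by rewrite -lj addnS ltnS leq_addr.
(* Here [b] is [B (l+1) m], [e] stands for [B (l+2) m], and [j = m - l - 1]: the first witness is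
   the recurrence shifted by one. *)
exists ((2 * m%:Z + 1) * b - (m%:Z + l%:Z + 2) * j%:Z * e), b; split.
- have : ~~ odd ((m + l + 2) * j)%N by rewrite -lj oddM !oddD /=; case: odd; case: odd.
  rewrite -dvdn2 => /dvdnP[q qE].
  have -> : (2 * m%:Z + 1) * b - (m%:Z + l%:Z + 2) * j%:Z * e
    = b + 2 * (m%:Z * b - q%:Z * e).
    have : (m%:Z + l%:Z + 2) * j%:Z = 2 * q%:Z by lia.
    by move=> ->; ring.
  by move: (_ - _) ob => z; lia.
- have rec := binom_transform_rec ltlm.
  (* As [m - l = j + 1], this multiplier turns [l! (j+1)!] into [(l+1)! j!] times the factor
     [(m+l+1)(m-l)] of the recurrence. *)
  have k0 : ((m + l).+1%:R * l.+1%:R : rat) != 0.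
    by rewrite mulf_neq0 // pnatr_eq0.
  apply: (mulfI k0).
  have mE : m%:R = l%:R + j%:R + 1 :> rat by rewrite -lj natrD -natr1 addrA.
  have -> : (m + l).+1%:R * l.+1%:R * ((l`! * m`! * j.+1`!)%:R * binom_transform m l)
    = (l.+1`! * m`! * j`!)%:R * ((m%:R + l%:R + 1) * (m%:R - l%:R) * binom_transform m l).
    by rewrite !factS !natrM -!natr1 natrD mE; ring.
  rewrite rec mulrBr.
  have -> : (l.+1`! * m`! * j`!)%:R * ((2 * m%:R + 1) * l.+1%:R * binom_transform m l.+1)
   = (2 * m%:R + 1) * l.+1%:R * ((l.+1`! * m`! * j`!)%:R * binom_transform m l.+1).
    by ring.
  have -> : (l.+1`! * m`! * j`!)%:R * (l.+1%:R * l.+2%:R * binom_transform m l.+2)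
   = l.+1%:R * ((l.+2`! * m`! * j`!)%:R * binom_transform m l.+2).
    by rewrite [l.+2`!]factS !natrM; ring.
  rewrite eb ee addnS !factS !natrM rmorphB !rmorphM !rmorphD /= !rmorphM /=.
  rewrite -!pmulrn -!natr1 natrD; ring.
- rewrite [j.+1`!]factS mulnA -addnS.
  have -> : (l.+1`! * m`! * j.+1 * j`!)%:R * binom_transform m l.+1
    = j.+1%:R * ((l.+1`! * m`! * j`!)%:R * binom_transform m l.+1).
    by rewrite !natrM; ring.
  by rewrite eb !natrM; ring.
Qed.

(** Cross-multiplying with the reduced form gives [numq q * d = n * denq q] with nonzero factors, on
    which [logn 2] is additive. *)
Lemma nu2_frac (q : rat) (n d : int) : n != 0 -> d != 0 -> q * d%:~R = n%:~R ->
  nu2 q = (logn 2 `|n|)%:Z - (logn 2 `|d|)%:Z.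
Proof.
move=> n0 d0 qE.
have e : (numq q * d = n * denq q)%R.
  apply: (@intr_inj rat); rewrite !rmorphM /= -qE -{2}(divq_num_den q).
  by field; rewrite intr_eq0 denq_neq0.
have q0 : numq q != 0.
  by rewrite numq_eq0; apply: contraNneq n0 => q0; rewrite -(intr_eq0 rat) -qE q0 mul0r.
have := congr1 (fun z => logn 2 `|z|) e.
have p z : z != 0 -> (0 < `|z|)%N by rewrite absz_gt0.
rewrite !abszM !lognM ?p ?denq_neq0 // /nu2; lia.
Qed.

Lemma logn2_odd n : odd n -> logn 2 n = 0%N.
Proof. by move=> on; rewrite lognE dvdn2 on /= andbF. Qed.

Lemma A_binom_transform l m : (l <= m)%N ->
  A l m * 2%:R ^+ (m - l) = (l`! * m`!)%:R * binom_transform m l.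
Proof.
move=> lelm; rewrite /A /binom_transform [in RHS](big_cat_nat (n := l)) //=; last exact: leqW.
rewrite [X in _ = _ * (X + _)]big1_seq => [|k]; last first.
  by rewrite mem_index_iota => /andP[_ /andP[_ ltkl]]; rewrite bin_small ?muln0.
by rewrite add0r mulrAC divfK // expf_neq0 // pnatr_eq0.
Qed.

(** Dividing the [2^m] of the transform by the [2^(m-l)] in [A] leaves [2^l]; the cofactor [b] is
    odd and contributes nothing. *)
Lemma nu2_A l m : (l <= m)%N ->
  nu2 (A l m) = l%:Z + (logn 2 (m + l)`!)%:Z - (logn 2 (m - l)`!)%:Z.
Proof.
move=> lelm.
have [b [_ [ob eb _]]] := binom_transform_odd (subnKC lelm).
have b0 : b != 0 by apply: contraTneq ob => ->.
rewrite (@nu2_frac _ ((2 ^ l * (m + l)`!)%:Z * b) (m - l)`!%:Z).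
- rewrite abszM /= lognM ?absz_gt0 ?muln_gt0 ?expn_gt0 ?fact_gt0 //.
  by rewrite (logn2_odd ob) addn0 lognM ?expn_gt0 ?fact_gt0 // pfactorK.
- by rewrite mulf_neq0 // -lt0n muln_gt0 expn_gt0 fact_gt0.
- by rewrite -lt0n fact_gt0.
have k0 : (2%:R ^+ (m - l) : rat) != 0 by rewrite expf_neq0 // pnatr_eq0.
apply: (mulfI k0).
rewrite rmorphM /= -!pmulrn mulrA.
have -> : 2%:R ^+ (m - l) * A l m = (l`! * m`!)%:R * binom_transform m l.
  by rewrite mulrC A_binom_transform.
rewrite mulrAC -natrM eb mulrA -natrX -natrM; congr (_%:R * _).
by rewrite mulnA -expnD subnK.
Qed.

Theorem theorem3p1 (l : nat) (hl : (1 <= l)%N) (m : nat) (hm : (l <= m)%N) :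
  nu2 (A l m.+1) - nu2 (A l m) =
  nu2 (m%:R + l%:R + 1) - nu2 (m%:R - l%:R + 1).
Proof.
(* From [m] to [m + 1] the term [l] cancels and the factorials gain only the factors [m + l + 1] and
   [m - l + 1]. *)
rewrite !nu2_A ?leqW // addSn subSn // !factS !lognM ?fact_gt0 //.
rewrite -natrB // -natrD !natr1 !pmulrn !nu2_int /=; lia.
Qed.
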